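(* Let $B=B(c_1,\dots,c_n)$ be a skyline board. Then, as an identity in $z$, $$\prod_{i=1}^n[z+c_i]_{aq^{-2c_i},\,bq^{-c_i};q,p}=\sum_{k=0}^n f_{n-k}(a,b;q,p;B)\,\big([z]_{a,b;q,p}\big)^k.$$
   Context: Theta functions: for $x\neq 0$ and $|p|<1$, $\theta(x;p)=\prod_{j\ge0}(1-p^jx)(1-p^{j+1}/x)$, $\theta(x_1,\dots,x_m;p)=\prod_l\theta(x_l;p)$. For nonzero complex $a,b,q$ (generic) define $w_{a,b;q,p}(k)=\frac{\theta(aq^{2k+1},bq^{k},aq^{k-2}/b;p)}{\theta(aq^{2k-1},bq^{k+2},aq^{k}/b;p)}\,q$ and $[z]_{a,b;q,p}=\frac{\theta(q^z,aq^z,bq^2,a/b;p)}{\theta(q,aq,bq^{z+1},aq^{z-1}/b;p)}$; subscripts like $[x]_{aq^{2s},bq^s;q,p}$ mean $(a,b)$ replaced by $(aq^{2s},bq^s)$. Cells $(i,j)$: column $i$, row $j$. For nonnegative integers $c_1,\dots,c_n$ (in any order) the skyline board is $B(c_1,\dots,c_n)=\{(i,j):1\le i\le n,1\le j\le c_i\}$. A file placement of $k$ rooks in $B$ is a set of $k$ cells of $B$ no two in the same column (two rooks may share a row); $\mathcal F_k(B)$ is the set of these. Each rook cancels all cells below it in its column. For $Q\in\mathcal F_k(B)$, $U_B(Q)$ is the set of cells of $B$ neither cancelled nor occupied, and $f_k(a,b;q,p;B)=\sum_{Q\in\mathcal F_k(B)}\prod_{(i,j)\in U_B(Q)}w_{a,b;q,p}(1-j)$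 is the elliptic file number. *)

(* Defs.v *)
From HB Require Import structures.
From mathcomp Require Import all_boot all_order all_algebra.
From mathcomp Require Import all_classical all_reals all_analysis.
From mathcomp Require Import complex.

Set Implicit Arguments.
Unset Strict Implicit.
Unset Printing Implicit Defensive.

Import Order.TTheory GRing.Theory Num.Theory.
Import numFieldNormedType.Exports.

Local Open Scope ring_scope.
Local Open Scope complex_scope.

Section EllipticWeights.
Variable R : realType.
Local Notation C := R[i].

Definition cexp (z : C) : C :=
  let: x +i* y := z in (expR x * cos y) +i* (expR x * sin y).

(* The alias [C^o] carries the topology of C. For [`|p| < 1] the limit exists;
   at [p = 0] the convention [0 ^+ 0 = 1] gives [theta x 0 = 1 - x]. *)
Definition theta (x p : C) : C :=
  limn ((fun N : nat =>
           \prod_(j < N) ((1 - p ^+ j * x) * (1 - p ^+ j.+1 / x)))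
        : nat -> C^o).

Definition thetas (xs : seq C) (p : C) : C := \prod_(x <- xs) theta x p.

(* The exponents are integers: [q ^ k] with [k : int]. *)
Definition w_num (a b q p : C) (k : int) : C :=
  thetas [:: a * q ^ (2 * k + 1); b * q ^ k; a * q ^ (k - 2) / b] p.

Definition w_den (a b q p : C) (k : int) : C :=
  thetas [:: a * q ^ (2 * k - 1); b * q ^ (k + 2); a * q ^ k / b] p.

Definition w (a b q p : C) (k : int) : C :=
  w_num a b q p k / w_den a b q p k * q.

(* For complex [z], the power [q^z] depends on a determination [l] of log q:
   [q = cexp l] and [q^z = cpow l z]. *)
Definition cpow (l z : C) : C := cexp (z * l).

Definition ellnum_num (a b l p z : C) : C :=
  let q := cexp l in
  thetas [:: cpow l z; a * cpow l z; b * q ^+ 2; a / b] p.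

Definition ellnum_den (a b l p z : C) : C :=
  let q := cexp l in
  thetas [:: q; a * q; b * cpow l (z + 1); a * cpow l (z - 1) / b] p.

Definition ellnum (a b l p z : C) : C :=
  ellnum_num a b l p z / ellnum_den a b l p z.

End EllipticWeights.

Section FilePlacements.
Variables n m : nat.

(* A cell [(i, j)] lies in column [i] and row [j]. Columns are numbered from 0,
   which is immaterial. Rows keep their actual numbers, which enter the weights;
   row 0 of the ambient grid belongs to no skyline board. *)
Definition cell := ('I_n * 'I_m)%type.

Definition file_placements (k : nat) (B : {set cell}) : {set {set cell}} :=
  [set Q : {set cell} | [&& Q \subset B, #|Q| == k &
     [forall x in Q, forall y in Q, (x.1 == y.1) ==> (x == y)]]].

Definition cancelled (Q : {set cell}) (x : cell) : bool :=
  [exists y in Q, (y.1 == x.1) && (x.2 < y.2)%N].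

Definition uncancelled (B Q : {set cell}) : {set cell} :=
  [set x in B | (x \notin Q) && ~~ cancelled Q x].

Definition file_number (R : realType) (a b q p : R[i]) (B : {set cell})
    (k : nat) : R[i] :=
  \sum_(Q in file_placements k B)
    \prod_(x in uncancelled B Q) w a b q p (1 - (x.2 : nat)%:Z).

End FilePlacements.

(* The ambient number of rows is just large enough to contain the row indices
   [0], ..., [\max_i c i]. *)
Definition skyline (n : nat) (c : 'I_n -> nat) :
    {set cell n (\max_(i < n) c i).+1} :=
  [set x : cell n (\max_(i < n) c i).+1 | (0 < x.2)%N && (x.2 <= c x.1)%N].

(* Main.v *)
(* The product over the columns expands into a sum over the choices, in every
   column, of either a rook or nothing; the contributions of one column of
   height c add up to E_c := [z+c]_(a q^(-2c), b q^(-c)), because of the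
   recursion E_(c+1) = 1 + w(-c) E_c. This recursion is an instance of the
   Weierstrass addition formula for theta.

   For the latter, expand theta (x y; p) theta (x / y; p) as a Laurent series
   sum_s c_s(y) x^s. Comparing with x |-> p x gives c_s = p^(s-2) c_(s-2), so
   the product equals c_0(y) A(x) + c_1(y) B(x): as a function of two
   variables it has rank at most 2, and it is antisymmetric up to a factor.
   The addition formula is the vanishing of a 4 x 4 Pfaffian. The Laurent
   coefficients are obtained as limits of those of the finite products; all
   limits are geometrically fast with ratio |p|. *)
Require Import Defs.
From HB Require Import structures.
From mathcomp Require Import all_boot all_order all_algebra.
From mathcomp Require Import all_classical all_reals all_analysis.
From mathcomp Require Import complex ring lra zify.
Import Order.TTheory GRing.Theory Num.Theory.
Import numFieldNormedType.Exports.
Local Open Scope classical_set_scope.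
Local Open Scope ring_scope.
Local Open Scope complex_scope.

(** * Complex limits at a geometric rate *)

Section GeometricLimits.
Set Implicit Arguments.
Unset Strict Implicit.
Variable R : realType.
Local Notation C := R[i].
Local Notation nc := (@ComplexField.Normc.normc R).

(** The ratio is fixed and the constant is free, so sums and products of such limits keep the same
    ratio. Since [limn] is total, this predicate is what certifies its value. *)
Definition glim (r : R) (u : nat -> C) (l : C) : Prop :=
  exists K : R, forall N, nc (u N - l) <= K * r ^+ N.

Lemma nc_ge0 (x : C) : 0 <= nc x.
Proof. by case: x => a b; exact: sqrtr_ge0. Qed.

Lemma ncM (x y : C) : nc (x * y) = nc x * nc y.
Proof. exact: ComplexField.Normc.normcM. Qed.

Lemma ncD (x y : C) : nc (x + y) <= nc x + nc y.
Proof. exact: le_normcD. Qed.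

Lemma ncN (x : C) : nc (- x) = nc x.
Proof. exact: normcN. Qed.

Lemma nc1 : nc 1 = 1.
Proof. exact: ComplexField.Normc.normc1. Qed.

Lemma nc0 : nc 0 = 0.
Proof. exact: ComplexField.Normc.normc0. Qed.

Lemma ncX (x : C) n : nc (x ^+ n) = nc x ^+ n.
Proof. by elim: n => [|n IH]; rewrite ?expr0 ?nc1 // !exprS ncM IH. Qed.

Lemma nc_eq0 (x : C) : (nc x == 0) = (x == 0).
Proof.
by apply/eqP/eqP => [/ComplexField.Normc.eq0_normc //|->]; exact: nc0.
Qed.

Lemma nc_gt0 (x : C) : (0 < nc x) = (x != 0).
Proof. by rewrite lt_def nc_ge0 andbT nc_eq0. Qed.

Lemma nc_Re (x : C) : `|complex.Re x| <= nc x.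
Proof.
by case: x => a b /=; rewrite -[`|a|]sqrtr_sqr ler_wsqrtr // lerDl sqr_ge0.
Qed.

Lemma nc_Im (x : C) : `|complex.Im x| <= nc x.
Proof.
by case: x => a b /=; rewrite -[`|b|]sqrtr_sqr ler_wsqrtr // lerDr sqr_ge0.
Qed.

Lemma nc_ReIm (x : C) : nc x <= `|complex.Re x| + `|complex.Im x|.
Proof.
case: x => a b /=; rewrite -[leRHS]ger0_norm ?addr_ge0 //.
rewrite -sqrtr_sqr ler_wsqrtr // sqrrD !real_normK ?num_real //.
by rewrite addrAC lerDl mulrn_wge0 // mulr_ge0.
Qed.

Lemma geo_cvg (K r : R) : 0 <= r < 1 ->
  (fun N => K * r ^+ N) @ \oo --> (0 : R).
Proof.
move=> /andP[r0 r1].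
have h : `|r| < 1 by rewrite ger0_norm.
exact: (cvg_geometric K h).
Qed.

Lemma glim_limn (r : R) (u : nat -> C) l : 0 <= r < 1 -> glim r u l ->
  limn (u : nat -> C^o) = l.
Proof.
move=> r01 [K HK]; apply: cvg_lim; first exact: norm_hausdorff.
apply/cvgrPdist_lt => /= e e0.
(* A positive complex number is real, so the radius [e] may be replaced by its real part. *)
have e0' : 0 < complex.Re e by move: e0; rewrite ltcE /= => /andP[].
have eE : e = (complex.Re e)%:C by rewrite RRe_real // gtr0_real.
have /cvgrPdist_lt /(_ _ e0') := geo_cvg K r01.
apply: filterS => N; rewrite sub0r normrN => hN.
rewrite distrC eE /= ltcR.
by apply: le_lt_trans (HK N) _; apply: le_lt_trans (ler_norm _) hN.
Qed.

(** With D = K / (1 - r), the intervals of center [v N] and radius [D * r ^+ N] are nested; the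
    limit is the supremum of their left ends. *)
Lemma real_geo_limit (K r : R) (v : nat -> R) : 0 <= r < 1 ->
  (forall N, `|v N.+1 - v N| <= K * r ^+ N) ->
  exists l, forall N, `|v N - l| <= K / (1 - r) * r ^+ N.
Proof.
move=> /andP[r0 r1] H.
have K0 : 0 <= K by have := le_trans (normr_ge0 _) (H 0%N); rewrite expr0 mulr1.
have r1' : 0 < 1 - r by rewrite subr_gt0.
(* The factor [1 - r ^+ k] keeps the geometric sum exact, as the nesting requires. *)
have bnd N k : `|v (N + k)%N - v N| <= K / (1 - r) * r ^+ N * (1 - r ^+ k).
  elim: k => [|k IH]; first by rewrite addn0 !subrr normr0 mulr0.
  rewrite -(subrK (v (N + k)%N) (v (N + k.+1)%N)) -addrA.
  apply: le_trans (ler_normD _ _) _.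
  rewrite addnS; apply: le_trans (lerD (H _) IH) _.
  rewrite le_eqVlt; apply/orP; left; apply/eqP.
  by rewrite exprD exprS; field; rewrite gt_eqF.
have bnd2 N k : `|v (N + k)%N - v N| <= K / (1 - r) * r ^+ N.
  apply: le_trans (bnd N k) _; rewrite ler_piMr //.
    by rewrite !mulr_ge0 ?invr_ge0 ?exprn_ge0 // ltW.
  by rewrite gerBl exprn_ge0.
set D := K / (1 - r).
have lo_le N k : v N - D * r ^+ N <= v (N + k)%N - D * r ^+ (N + k).
  have := bnd N k; rewrite ler_norml => /andP[h _].
  by move: h; rewrite -/D exprD; nra.
have up_ge N k : v (N + k)%N + D * r ^+ (N + k) <= v N + D * r ^+ N.
  have := bnd N k; rewrite ler_norml => /andP[_ h].
  by move: h; rewrite -/D exprD; nra.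
have D0 : 0 <= D by rewrite mulr_ge0 ?invr_ge0 // ltW.
have lo_up M N : v M - D * r ^+ M <= v N + D * r ^+ N.
  apply: le_trans (lo_le M N) _; apply: le_trans (up_ge N M).
  rewrite [(N + M)%N]addnC lerD2l.
  by apply: (@le_trans _ _ 0); rewrite ?oppr_le0 mulr_ge0 ?exprn_ge0.
pose S := range (fun N => v N - D * r ^+ N).
have Sub M : ubound S (v M + D * r ^+ M).
  by move=> _ [N _ <-]; exact: lo_up.
have hS : has_sup S.
  split; first by exists (v 0%N - D * r ^+ 0); exists 0%N.
  by exists (v 0%N + D * r ^+ 0); exact: Sub.
exists (sup S) => N; rewrite ler_distlC; apply/andP; split.
  by apply: ub_le_sup; [exact: hS.2 | exists N].
by apply: ge_sup; [exact: hS.1 | exact: Sub].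
Qed.

Lemma geo_limit (K r : R) (u : nat -> C) : 0 <= r < 1 ->
  (forall N, nc (u N.+1 - u N) <= K * r ^+ N) ->
  exists l, forall N, nc (u N - l) <= 2 * K / (1 - r) * r ^+ N.
Proof.
move=> r01 H.
have [x Hx] : exists x, forall N,
    `|complex.Re (u N) - x| <= K / (1 - r) * r ^+ N.
  apply: real_geo_limit => // N; apply: le_trans (H N); rewrite -raddfB.
  exact: nc_Re.
have [y Hy] : exists y, forall N,
    `|complex.Im (u N) - y| <= K / (1 - r) * r ^+ N.
  apply: real_geo_limit => // N; apply: le_trans (H N); rewrite -raddfB.
  exact: nc_Im.
exists (x +i* y) => N; apply: le_trans (nc_ReIm _) _; rewrite !raddfB /=.
by apply: le_trans (lerD (Hx N) (Hy N)) _; rewrite -mulrA; lra.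
Qed.

Lemma glim_unique (r : R) (u : nat -> C) (l l' : C) : 0 <= r < 1 ->
  glim r u l -> glim r u l' -> l = l'.
Proof. by move=> r01 /(glim_limn r01) <- /(glim_limn r01) <-. Qed.

Lemma glim_ext (r : R) (u v : nat -> C) l : u =1 v -> glim r u l -> glim r v l.
Proof. by move=> uv [K H]; exists K => N; rewrite -uv. Qed.

Lemma glim_cst (r : R) (l : C) : glim r (fun=> l) l.
Proof. by exists 0 => N; rewrite subrr nc0 mul0r. Qed.

Lemma glimD (r : R) (u v : nat -> C) l m :
  glim r u l -> glim r v m -> glim r (fun N => u N + v N) (l + m).
Proof.
move=> [K HK] [L HL]; exists (K + L) => N.
by rewrite opprD addrACA mulrDl (le_trans (ncD _ _) (lerD (HK N) (HL N))).
Qed.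

Lemma glimN (r : R) (u : nat -> C) l :
  glim r u l -> glim r (fun N => - u N) (- l).
Proof. by move=> [K HK]; exists K => N; rewrite -opprD ncN. Qed.

Lemma glimB (r : R) (u v : nat -> C) l m :
  glim r u l -> glim r v m -> glim r (fun N => u N - v N) (l - m).
Proof. by move=> hu /glimN; exact: glimD. Qed.

Lemma glimM (r : R) (u v : nat -> C) l m : 0 <= r < 1 ->
  glim r u l -> glim r v m -> glim r (fun N => u N * v N) (l * m).
Proof.
move=> /andP[r0 r1] [K HK] [L HL].
have K0 : 0 <= K by have := le_trans (nc_ge0 _) (HK 0%N); rewrite expr0 mulr1.
exists (K * (nc m + L) + nc l * L) => N.
have -> : u N * v N - l * m = (u N - l) * v N + l * (v N - m) by ring.
apply: le_trans (ncD _ _) _; rewrite !ncM mulrDl lerD //; last first.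
  by rewrite -mulrA ler_wpM2l ?nc_ge0.
rewrite mulrAC ler_pM ?nc_ge0 //; rewrite -[v N](subrKC m).
apply: le_trans (ncD _ _) _; rewrite lerD2l; apply: le_trans (HL N) _.
rewrite ler_piMr ?exprn_ile1 ?(ltW r1) //.
by have := le_trans (nc_ge0 _) (HL 0%N); rewrite expr0 mulr1.
Qed.

End GeometricLimits.

(** * Partial products of theta and the inversion formula *)

Section ThetaProducts.
Set Implicit Arguments.
Unset Strict Implicit.
Variable R : realType.
Local Notation C := R[i].
Local Notation nc := (@ComplexField.Normc.normc R).

Definition theta_prod (p x : C) (N : nat) : C :=
  \prod_(j < N) ((1 - p ^+ j * x) * (1 - p ^+ j.+1 / x)).

(** Since 1 + t <= exp t, the product is at most the exponential of a geometric sum, uniformly in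
    [N]. *)
Lemma prod_geo_bound (K r : R) N : 0 <= K -> 0 <= r < 1 ->
  \prod_(j < N) (1 + K * r ^+ j) <= expR (K / (1 - r)).
Proof.
move=> K0 /andP[r0 r1].
have r1' : 0 < 1 - r by rewrite subr_gt0.
have : \prod_(j < N) (1 + K * r ^+ j) <= expR (K / (1 - r) * (1 - r ^+ N)).
  elim: N => [|N IH]; first by rewrite big_ord0 expr0 subrr mulr0 expR0.
  rewrite big_ord_recr /=.
  have -> : K / (1 - r) * (1 - r ^+ N.+1) =
      K / (1 - r) * (1 - r ^+ N) + K * r ^+ N.
    by rewrite exprS; field; rewrite gt_eqF.
  rewrite expRD ler_pM ?expR_ge1Dx ?addr_ge0 ?mulr_ge0 ?exprn_ge0 //.
  by apply: prodr_ge0 => j _; rewrite addr_ge0 ?mulr_ge0 ?exprn_ge0.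
move/le_trans; apply; rewrite ler_expR ler_piMr ?gerBl ?exprn_ge0 //.
by rewrite mulr_ge0 ?invr_ge0 // ltW.
Qed.

(** The [N]-th factor is within [K * nc p ^+ N] of 1, and [prod_geo_bound] keeps the partial
    products bounded. *)
Lemma theta_prod_diff (p x : C) : nc p < 1 ->
  exists K, forall N, nc (theta_prod p x N.+1 - theta_prod p x N) <= K * nc p ^+ N.
Proof.
move=> p1; have p0 := nc_ge0 p; have p01 : 0 <= nc p < 1 by rewrite p0.
pose K := nc x + nc (p / x) + nc x * nc (p / x).
have K0 : 0 <= K by rewrite !addr_ge0 ?mulr_ge0 ?nc_ge0.
have fac j : nc ((1 - p ^+ j * x) * (1 - p ^+ j.+1 / x) - 1) <= K * nc p ^+ j.
  have -> : (1 - p ^+ j * x) * (1 - p ^+ j.+1 / x) - 1 =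
     p ^+ j * (p ^+ j * x * (p / x) - x - p / x) by rewrite exprS; ring.
  rewrite ncM ncX mulrC ler_wpM2r ?exprn_ge0 //.
  apply: le_trans (ncD _ _) _; rewrite ncN.
  apply: le_trans (lerD (ncD _ _) (lexx _)) _; rewrite ncN 2!ncM ncX /K.
  have : nc p ^+ j * nc x * nc (p / x) <= nc x * nc (p / x).
    by rewrite -mulrA ler_piMl ?mulr_ge0 ?nc_ge0 // exprn_ile1 // ltW.
  lra.
exists (expR (K / (1 - nc p)) * K) => N.
rewrite /theta_prod big_ord_recr /= -/(theta_prod p x N).
set f := (X in _ * X); have -> : theta_prod p x N * f - theta_prod p x N =
  theta_prod p x N * (f - 1) by ring.
rewrite ncM -mulrA ler_pM ?nc_ge0 ?fac //.
apply: le_trans (prod_geo_bound N K0 p01).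
elim: N {f} => [|N IH]; first by rewrite /theta_prod !big_ord0 nc1.
rewrite /theta_prod !big_ord_recr /= ncM ler_pM ?nc_ge0 //.
set f := (X in nc X); rewrite -[f](subrKC 1); apply: le_trans (ncD _ _) _.
by rewrite nc1 lerD2l fac.
Qed.

Lemma theta_glim (p x : C) : nc p < 1 ->
  glim (nc p) (theta_prod p x) (theta x p).
Proof.
move=> p1; have p01 : 0 <= nc p < 1 by rewrite nc_ge0.
have [K HK] := theta_prod_diff x p1.
have [l Hl] := geo_limit p01 HK.
have gl : glim (nc p) (theta_prod p x) l by exists (2 * K / (1 - nc p)).
suff -> : theta x p = l by [].
exact: (glim_limn p01 gl).
Qed.

(** The finite products satisfy the formula exactly once multiplied by the boundary factors 1 - p^N
    / x and 1 - p^N x, which tend to 1. *)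
Lemma theta_inv (p x : C) : nc p < 1 -> x != 0 -> x * theta x^-1 p = - theta x p.
Proof.
move=> p1 x0; have p01 : 0 <= nc p < 1 by rewrite nc_ge0.
have geo : glim (nc p) (fun N => p ^+ N) 0.
  by exists 1 => N; rewrite subr0 mul1r ncX.
have gc c : glim (nc p) (fun N => 1 - p ^+ N * c) 1.
  rewrite -[X in glim _ _ X]subr0 -[X in _ - X](mul0r c).
  by apply: glimB; [exact: glim_cst|apply: glimM => //; exact: glim_cst].
have h1 : glim (nc p) (fun N => x * (theta_prod p x^-1 N * (1 - p ^+ N / x)))
    (x * (theta x^-1 p * 1)).
  by apply: glimM => //; [exact: glim_cst|apply: glimM => //; exact: theta_glim].
have h2 : glim (nc p) (fun N => - (theta_prod p x N * (1 - p ^+ N * x)))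
    (- (theta x p * 1)).
  by apply: glimN; apply: glimM => //; exact: theta_glim.
move: h1 h2; rewrite !mulr1 => h1 h2; apply: (glim_unique p01 h1).
apply: glim_ext h2 => N /=.
elim: N => [|N IH]; first by rewrite /theta_prod !big_ord0 expr0; field.
rewrite /theta_prod !big_ord_recr /= -!/(theta_prod _ _ _) invrK.
have -> : x * (theta_prod p x^-1 N * ((1 - p ^+ N / x) * (1 - p ^+ N.+1 * x)) *
   (1 - p ^+ N.+1 / x)) = (x * (theta_prod p x^-1 N * (1 - p ^+ N / x))) *
   ((1 - p ^+ N.+1 * x) * (1 - p ^+ N.+1 / x)) by ring.
by rewrite -IH; ring.
Qed.

End ThetaProducts.

(** * Laurent coefficients of the finite products *)

Section ThetaCoefficients.
Set Implicit Arguments.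
Unset Strict Implicit.
Variables (R : realType) (p g : R[i]).
Local Notation C := R[i].
Local Notation nc := (@ComplexField.Normc.normc R).
Hypothesis p0 : p != 0.

Let k2 N := p ^+ N ^+ 2.
Let k1 N := - p ^+ N * g * (1 + p ^+ N ^+ 2 * p).
Let k0 N := 1 + p ^+ N ^+ 2 * p * g ^+ 2 + p ^+ N ^+ 4 * p ^+ 2.

(* [pair_coef N s] is the coefficient of x^s in
   [theta_prod p (x * y) N * theta_prod p (x / y) N], where [g = y + y^-1];
   [k2 N], [k1 N], [k0 N], [p * k1 N], [p ^+ 2 * k2 N] are the coefficients of
   x^2, ..., x^-2 in the N-th factor
   (1 - e g x + e^2 x^2) (1 - e p g / x + e^2 p^2 / x^2), e = p^N. *)
Fixpoint pair_coef (N : nat) (s : int) : C :=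
  if N is N'.+1 then
    k2 N' * pair_coef N' (s - 2) + k1 N' * pair_coef N' (s - 1) +
    k0 N' * pair_coef N' s +
    p * k1 N' * pair_coef N' (s + 1) + p ^+ 2 * k2 N' * pair_coef N' (s + 2)
  else (s == 0)%:R.

Lemma pair_coef_supp N (s : int) : (2 * N < `|s|)%N -> pair_coef N s = 0.
Proof.
elim: N s => [|N IH] s hs /=; first by case: eqP hs => // ->.
by rewrite !IH; [ring|lia..].
Qed.

(** Every factor, hence every partial product, is invariant under replacing x by p / x. *)
Lemma pair_coef_sym N (s : int) : pair_coef N (- s) = p ^ s * pair_coef N s.
Proof.
elim: N s => [|N IH] s /=.
  by rewrite oppr_eq0; case: eqP => [->|]; rewrite ?mulr0 ?expr0z ?mulr1.
have -> : - s - 2 = - (s + 2) by ring.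
have -> : - s - 1 = - (s + 1) by ring.
have -> : - s + 1 = - (s - 1) by ring.
have -> : - s + 2 = - (s - 2) by ring.
rewrite !IH !(expfzDr s) //.
have -> : p ^ (-1) = p^-1 by [].
have -> : p ^ (-2) = p ^- 2 by [].
have -> : p ^ 1 = p by [].
have -> : p ^ 2 = p ^+ 2 by [].
by field.
Qed.

(* Coefficientwise form of F(p x) (x^2 - e g x + e^2) = F(x) (1 - e g x + e^2 x^2)
   for the N-th partial product F, with e = p^N. *)
Lemma pair_coef_rec N (s : int) :
  p ^ (s - 2) * pair_coef N (s - 2) - p ^+ N * g * p ^ (s - 1) * pair_coef N (s - 1) +
    p ^+ N ^+ 2 * p ^ s * pair_coef N s =
  pair_coef N s - p ^+ N * g * pair_coef N (s - 1) + p ^+ N ^+ 2 * pair_coef N (s - 2).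
Proof.
elim: N s => [|N IH] s /=.
  have e t : p ^ t * (t == 0)%:R = (t == 0)%:R.
    by case: eqP => [->|_]; rewrite ?mulr0 // expr0z mul1r.
  have E (P a Q b S c : C) : P * a = a -> Q * b = b -> S * c = c ->
      P * a - 1 * g * Q * b + 1 * S * c = c - 1 * g * b + 1 * a.
    move=> h1 h2 h3; have -> : 1 * g * Q * b = g * (Q * b) by ring.
    by rewrite h1 h2 -[1 * S * c]mulrA h3; ring.
  by rewrite !expr0 !expr1n E.
have r0 := IH s; have r1 := IH (s - 1); have r2 := IH (s - 2).
have r3 := IH (s + 1); have r4 := IH (s + 2).
have E1 : s - 2 - 2 = s - 4 by ring.
have E2 : s - 2 - 1 = s - 3 by ring.
have E3 : s - 2 + 1 = s - 1 by ring.
have E4 : s - 2 + 2 = s by ring.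
have E5 : s - 1 - 2 = s - 3 by ring.
have E6 : s - 1 - 1 = s - 2 by ring.
have E7 : s - 1 + 1 = s by ring.
have E8 : s - 1 + 2 = s + 1 by ring.
have E9 : s + 1 - 2 = s - 1 by ring.
have E10 : s + 1 - 1 = s by ring.
have E11 : s + 2 - 2 = s by ring.
have E12 : s + 2 - 1 = s + 1 by ring.
move: r0 r1 r2 r3 r4.
rewrite ?(E1, E2, E3, E4, E5, E6, E7, E8, E9, E10, E11, E12).
rewrite !(expfzDr s) //.
have -> : p ^ (-1) = p^-1 by [].
have -> : p ^ (-2) = p ^- 2 by [].
have -> : p ^ (-3) = p ^- 3 by [].
have -> : p ^ (-4) = p ^- 4 by [].
have -> : p ^ 1 = p by [].
have -> : p ^ 2 = p ^+ 2 by [].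
rewrite /k2 /k1 /k0 (exprS p N).
move: (p ^ s) (p ^+ N) (pair_coef N (s - 4)) (pair_coef N (s - 3)) (pair_coef N (s - 2))
  (pair_coef N (s - 1)) (pair_coef N s) (pair_coef N (s + 1)) (pair_coef N (s + 2)).
move=> P e a4 a3 a2 a1 b0 b1 b2.
move=> /eqP; rewrite -subr_eq0 => /eqP r0 /eqP; rewrite -subr_eq0 => /eqP r1.
move=> /eqP; rewrite -subr_eq0 => /eqP r2 /eqP; rewrite -subr_eq0 => /eqP r3.
move=> /eqP; rewrite -subr_eq0 => /eqP r4.
apply/eqP; rewrite -subr_eq0; apply/eqP.
(* The relation for N.+1 is the combination of those for N at s, s -+ 1, s -+ 2
   whose weights are the coefficients of
   (1 - f g x + f^2 x^2) (1 - f g / x + f^2 / x^2). *)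
pose f := p * e.
have Z (x y z t u : C) : x * 0 + y * 0 + z * 0 + t * 0 + u * 0 = 0 :> C by ring.
rewrite -[RHS](Z (1 + f ^+ 2 * g ^+ 2 + f ^+ 4) (- f * g * (1 + f ^+ 2))
  (f ^+ 2) (- f * g * (1 + f ^+ 2)) (f ^+ 2)).
rewrite -{1}r0 -{1}r1 -{1}r2 -{1}r3 -r4 /f.
field.
by [].
Qed.

End ThetaCoefficients.

(** * Limits of the Laurent coefficients *)

Section CoefficientLimits.
Set Implicit Arguments.
Unset Strict Implicit.
Variables (R : realType) (p : R[i]).
Local Notation C := R[i].
Local Notation nc := (@ComplexField.Normc.normc R).
Hypotheses (p0 : p != 0) (p1 : nc p < 1).

Let r := nc p.
Let r0 : 0 <= r. Proof. exact: nc_ge0. Qed.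
Let r01 : 0 <= r < 1. Proof. by rewrite r0. Qed.
Let rN_ge0 N : 0 <= r ^+ N. Proof. exact: exprn_ge0. Qed.
Let rN_le1 N : r ^+ N <= 1. Proof. by rewrite exprn_ile1 // ltW. Qed.

Section FixedParameter.
Variable g : C.
Let G := nc g.

(** In the norm sup_s |c_s| rho^s, multiplication by x^j costs rho^j. Up to [r ^+ N], this bounds
    the total cost of the five terms of the [N]-th factor minus 1. *)
Definition growth (rho : R) : R :=
  rho ^ 2 + 2 * G * rho ^ 1 + (G ^+ 2 + 1) * rho ^ 0 + 2 * G * rho ^ (-1) +
  rho ^ (-2).

Let G0 : 0 <= G. Proof. exact: nc_ge0. Qed.

Lemma growth_ge0 rho : 0 < rho -> 0 <= growth rho.
Proof.
by move=> rho0; rewrite !addr_ge0 ?mulr_ge0 ?addr_ge0 ?exprz_ge0 ?sqr_ge0 // ltW.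
Qed.

Lemma pair_coef_step rho N M (s : int) : 0 < rho ->
  (forall s, nc (pair_coef p g N s) * rho ^ s <= M) ->
  nc (pair_coef p g N.+1 s - pair_coef p g N s) * rho ^ s <= growth rho * r ^+ N * M.
Proof.
move=> rho0 HM.
have rs t : 0 < rho ^ t by rewrite exprz_gt0.
have M0 : 0 <= M.
  by apply: le_trans (HM 0); rewrite mulr_ge0 ?nc_ge0 // ltW.
have term (k : C) (t : R) (j : int) : 0 <= t -> nc k <= t * r ^+ N ->
    nc (k * pair_coef p g N (s + j)) * rho ^ s <= t * rho ^ (- j) * r ^+ N * M.
  move=> t0 kt; have -> : rho ^ s = rho ^ (s + j) * rho ^ (- j).
    by rewrite -expfzDr ?gt_eqF // addrK.
  rewrite ncM.
  have -> : nc k * nc (pair_coef p g N (s + j)) * (rho ^ (s + j) * rho ^ (- j)) =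
    nc k * (nc (pair_coef p g N (s + j)) * rho ^ (s + j)) * rho ^ (- j) by ring.
  have -> : t * rho ^ (- j) * r ^+ N * M = t * r ^+ N * M * rho ^ (- j) by ring.
  rewrite ler_wpM2r ?(ltW (rs _)) //.
  by apply: ler_pM; rewrite ?mulr_ge0 ?nc_ge0 // ltW.
(* The summand 1 of the middle coefficient cancels; every remaining coefficient carries a factor
   [p ^+ N]. *)
have -> : pair_coef p g N.+1 s - pair_coef p g N s =
    p ^+ N ^+ 2 * pair_coef p g N (s + -2) +
    (- p ^+ N * g * (1 + p ^+ N ^+ 2 * p)) * pair_coef p g N (s + -1) +
    (p ^+ N ^+ 2 * p * g ^+ 2 + p ^+ N ^+ 4 * p ^+ 2) * pair_coef p g N (s + 0) +
    (p * (- p ^+ N * g * (1 + p ^+ N ^+ 2 * p))) * pair_coef p g N (s + 1) +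
    (p ^+ 2 * p ^+ N ^+ 2) * pair_coef p g N (s + 2).
  by rewrite addr0 /=; ring.
have e1 : nc (p ^+ N) = r ^+ N by rewrite ncX.
have e2 : r ^+ N ^+ 2 <= r ^+ N by rewrite expr2 ler_piMr.
have e4 : r ^+ N ^+ 4 <= r ^+ N.
  by rewrite (exprS _ 3) ler_piMr // exprn_ile1.
have rle1 : r <= 1 by rewrite ltW.
have b1 : nc (- p ^+ N * g * (1 + p ^+ N ^+ 2 * p)) <= 2 * G * r ^+ N.
  rewrite !ncM ncN e1 -/G.
  have -> : 2 * G * r ^+ N = r ^+ N * G * 2 by ring.
  rewrite ler_wpM2l ?mulr_ge0 //; apply: le_trans (ncD _ _) _.
  rewrite nc1 (_ : 2 = 1 + 1) // lerD2l ncM ncX e1.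
  by rewrite -[1]mulr1 ler_pM ?exprn_ge0 // exprn_ile1.
have b0 : nc (p ^+ N ^+ 2 * p * g ^+ 2 + p ^+ N ^+ 4 * p ^+ 2) <=
    (G ^+ 2 + 1) * r ^+ N.
  have q1 : nc (p ^+ N ^+ 2 * p * g ^+ 2) = r ^+ N ^+ 2 * r * G ^+ 2.
    by rewrite 2!ncM !ncX.
  have q2 : nc (p ^+ N ^+ 4 * p ^+ 2) = r ^+ N ^+ 4 * r ^+ 2.
    by rewrite ncM !ncX.
  apply: le_trans (ncD _ _) _; rewrite q1 q2 mulrDl mul1r lerD //.
    have h : r ^+ N ^+ 2 * r <= r ^+ N * 1.
      exact: ler_pM (exprn_ge0 2 (rN_ge0 N)) r0 e2 rle1.
    by move: (ler_wpM2r (exprn_ge0 2 G0) h); rewrite mulr1 [r ^+ N * _]mulrC.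
  have r2 : r ^+ 2 <= 1 by rewrite exprn_ile1.
  by have := ler_pM (exprn_ge0 4 (rN_ge0 N)) (exprn_ge0 2 r0) e4 r2; rewrite mulr1.
have b2 : nc (p ^+ N ^+ 2) <= 1 * r ^+ N by rewrite ncX e1 mul1r.
have c1 : nc (p * (- p ^+ N * g * (1 + p ^+ N ^+ 2 * p))) <= 2 * G * r ^+ N.
  rewrite ncM -/r -[leRHS]mul1r.
  exact: ler_pM r0 (nc_ge0 _) rle1 b1.
have c2 : nc (p ^+ 2 * p ^+ N ^+ 2) <= 1 * r ^+ N.
  have r2 : nc (p ^+ 2) <= 1 by rewrite ncX exprn_ile1.
  rewrite ncM -[leRHS]mul1r.
  exact: ler_pM (nc_ge0 _) (nc_ge0 _) r2 b2.
have GG : 0 <= 2 * G by rewrite mulr_ge0.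
have GG1 : 0 <= G ^+ 2 + 1 by rewrite addr_ge0 ?exprn_ge0.
have t2 := term _ _ (-2) ler01 b2.
have t1 := term _ _ (-1) GG b1.
have t0 := term _ _ 0 GG1 b0.
have s1 := term _ _ 1 GG c1.
have s2 := term _ _ 2 ler01 c2.
have -> : growth rho * r ^+ N * M =
  1 * rho ^ 2 * r ^+ N * M + 2 * G * rho ^ 1 * r ^+ N * M +
  (G ^+ 2 + 1) * rho ^ 0 * r ^+ N * M + 2 * G * rho ^ (-1) * r ^+ N * M +
  1 * rho ^ (-2) * r ^+ N * M by rewrite /growth; ring.
have tri (x y : C) (u v : R) : nc x * rho ^ s <= u -> nc y * rho ^ s <= v ->
    nc (x + y) * rho ^ s <= u + v.
  move=> hx hy; apply: le_trans (ler_wpM2r (ltW (rs s)) (ncD _ _)) _.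
  by rewrite mulrDl lerD.
exact: tri _ _ _ _ (tri _ _ _ _ (tri _ _ _ _ (tri _ _ _ _ t2 t1) t0) s1) s2.
Qed.

(** Each step multiplies the weighted norm by at most [1 + growth rho * r ^+ N], so the norms stay
    bounded by [prod_geo_bound]. The bound is uniform in [s], for every weight [rho]. *)
Lemma pair_coef_geo rho : 0 < rho -> exists K, forall N s,
  nc (pair_coef p g N.+1 s - pair_coef p g N s) * rho ^ s <= K * r ^+ N.
Proof.
move=> rho0; have K0 := growth_ge0 rho0.
have rs t : 0 < rho ^ t by rewrite exprz_gt0.
pose M N := \prod_(j < N) (1 + growth rho * r ^+ j).
have HM N s : nc (pair_coef p g N s) * rho ^ s <= M N.
  elim: N s => [|N IH] s.
    rewrite /M big_ord0 /=; case: eqP => [->|_]; first by rewrite nc1 expr0z mulr1.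
    by rewrite nc0 mul0r.
  have -> : M N.+1 = M N * (1 + growth rho * r ^+ N) by rewrite /M big_ord_recr.
  rewrite -[pair_coef p g N.+1 s](subrKC (pair_coef p g N s)).
  apply: le_trans (ler_wpM2r (ltW (rs s)) (ncD _ _)) _.
  rewrite mulrDl mulrDr mulr1 lerD ?IH // [M N * _]mulrC.
  exact: pair_coef_step.
exists (growth rho * expR (growth rho / (1 - r))) => N s.
apply: le_trans (pair_coef_step s rho0 (HM N)) _.
by rewrite mulrAC ler_wpM2r // ler_wpM2l // prod_geo_bound.
Qed.

Definition pair_coef_lim (s : int) : C :=
  limn ((fun N => pair_coef p g N s) : nat -> C^o).

Lemma pair_coef_lim_bound rho : 0 < rho -> exists K, forall N s,
  nc (pair_coef p g N s - pair_coef_lim s) * rho ^ s <= K * r ^+ N.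
Proof.
move=> rho0; have [K HK] := pair_coef_geo rho0.
have rs t : 0 < rho ^ t by rewrite exprz_gt0.
exists (2 * K / (1 - r)) => N s.
(* At fixed [s] the constant is [K / rho ^ s]; multiplying back by [rho ^ s] restores uniformity in
   [s]. *)
have [|l Hl] := @geo_limit _ (K / rho ^ s) r (fun N => pair_coef p g N s) r01.
  by move=> n; rewrite mulrAC ler_pdivlMr.
have -> : pair_coef_lim s = l.
  by apply: (glim_limn r01); exists (2 * (K / rho ^ s) / (1 - r)).
rewrite -ler_pdivlMr //; apply: le_trans (Hl N) _.
by rewrite le_eqVlt; apply/orP; left; apply/eqP; ring.
Qed.

Lemma pair_coef_lim_glim s : glim r (fun N => pair_coef p g N s) (pair_coef_lim s).
Proof.
have [K HK] := pair_coef_lim_bound ltr01.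
by exists K => N; have := HK N s; rewrite exp1rz mulr1.
Qed.

(** In [pair_coef_rec] at s = n + 2, all other terms carry a power of [p ^+ N] and vanish in the
    limit. *)
Lemma pair_coef_lim_rec (n : nat) : pair_coef_lim n.+2 = p ^+ n * pair_coef_lim n.
Proof.
have gp : glim r (fun N => p ^+ N) 0.
  by exists 1 => N; rewrite subr0 mul1r ncX.
have gp2 : glim r (fun N => p ^+ N ^+ 2) 0.
  have := glimM r01 gp gp; rewrite mul0r; apply: glim_ext => N.
  by rewrite expr2.
have c t := pair_coef_lim_glim t; have k := @glim_cst R r.
have h1 := glimD (glimB (glimM r01 (k (p ^+ n)) (c n))
  (glimM r01 gp (glimM r01 (k (g * p ^ (n.+1 : int))) (c n.+1))))
  (glimM r01 gp2 (glimM r01 (k (p ^ (n.+2 : int))) (c n.+2))).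
have h2 := glimD (glimB (c n.+2) (glimM r01 gp (glimM r01 (k g) (c n.+1))))
   (glimM r01 gp2 (c n)).
move: h1 h2; rewrite !mul0r !subr0 !addr0 => h1 h2.
apply: (glim_unique r01 h2); apply: glim_ext h1 => N.
have := pair_coef_rec g p0 N n.+2.
have -> : n.+2%:Z - 2 = n by rewrite -addn2 PoszD addrK.
have -> : n.+2%:Z - 1 = n.+1 by rewrite -addn1 PoszD addrK.
by rewrite !mulrA => ->.
Qed.

(** Separates the dependence on [n] from that on [g]: even coefficients are multiples of the one at
    0, odd ones of the one at 1. This is the source of rank 2. *)
Fixpoint rank_coef (n : nat) : C :=
  if n is n'.+2 then p ^+ n' * rank_coef n' else 1.

Lemma pair_coef_lim_rank (n : nat) :
  pair_coef_lim n = rank_coef n * pair_coef_lim (odd n).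
Proof.
suff : pair_coef_lim n = rank_coef n * pair_coef_lim (odd n) /\
    pair_coef_lim n.+1 = rank_coef n.+1 * pair_coef_lim (odd n.+1) by case.
elim: n => [|n [IH1 IH2]]; first by rewrite /= !mul1r.
by split=> //; rewrite pair_coef_lim_rec IH1 /= negbK mulrA.
Qed.

End FixedParameter.

Definition bisum (v : int -> C) (L : nat) : C :=
  v 0 + \sum_(j < L) (v j.+1 + v (- j.+1%:Z)).

Lemma bisum_ext u v L : u =1 v -> bisum u L = bisum v L.
Proof.
by move=> uv; rewrite /bisum uv; congr +%R; apply: eq_bigr => j _; rewrite !uv.
Qed.

Lemma bisumD u v L : bisum (fun s => u s + v s) L = bisum u L + bisum v L.
Proof.
rewrite /bisum [RHS]addrACA -big_split; congr +%R.
by apply: eq_bigr => j _; rewrite addrACA.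
Qed.

Lemma bisumZ a v L : bisum (fun s => a * v s) L = a * bisum v L.
Proof.
by rewrite /bisum mulrDr mulr_sumr; congr +%R; apply: eq_bigr => j _; rewrite mulrDr.
Qed.

Lemma bisum_shiftS v L :
  bisum (fun s => v (s + 1)) L = bisum v L + v L.+1 - v (- L%:Z).
Proof.
rewrite /bisum; elim: L => [|L IH].
  by rewrite !big_ord0 !addr0 add0r oppr0 addrAC subrr add0r.
have e1 : L.+1%:Z + 1 = L.+2 by rewrite -[in RHS]addn1 PoszD.
have e2 : - L.+1%:Z + 1 = - L%:Z by rewrite -addn1 PoszD opprD addrNK.
rewrite !big_ord_recr /= addrA IH e1 e2; ring.
Qed.

Lemma bisum_shiftP v L :
  bisum (fun s => v (s - 1)) L = bisum v L + v (- L.+1%:Z) - v L.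
Proof.
rewrite /bisum; elim: L => [|L IH].
  by rewrite !big_ord0 !addr0 add0r addrAC subrr add0r.
have e1 : L.+1%:Z - 1 = L by rewrite -addn1 PoszD addrK.
have e2 : - L.+1%:Z - 1 = - L.+2%:Z by rewrite -[in RHS]addn1 PoszD opprD.
rewrite !big_ord_recr /= addrA IH e1 e2; ring.
Qed.

(** The recursion of [pair_coef] is multiplication by the next factor. For N + 1 one has L >= 2 N +
    2, so index shifts by up to two have zero boundary terms. *)
Lemma theta_prod_bisum (x y : C) N L : x != 0 -> y != 0 -> (2 * N <= L)%N ->
  theta_prod p (x * y) N * theta_prod p (x / y) N =
  bisum (fun s => pair_coef p (y + y^-1) N s * x ^ s) L.
Proof.
move=> x0 y0; elim: N L => [|N IH] L hL.
  rewrite /theta_prod !big_ord0 mulr1 /bisum /= expr0z mulr1 big1 ?addr0 // => j _.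
  by rewrite !mul0r addr0.
set g := y + y^-1; set v := fun s => pair_coef p g N s * x ^ s.
have v0 s : (2 * N < `|s|)%N -> v s = 0 by move=> h; rewrite /v pair_coef_supp ?mul0r.
have hv : theta_prod p (x * y) N * theta_prod p (x / y) N = bisum v L.
  by apply: IH; lia.
have m1 : bisum (fun s => v (s - 1)) L = bisum v L.
  by rewrite bisum_shiftP !v0 ?subr0 ?addr0 //; lia.
have m2 : bisum (fun s => v (s - 2)) L = bisum v L.
  rewrite -[RHS]m1 -(bisum_ext L (u := fun s => v (s - 1 - 1))).
    by rewrite (bisum_shiftP (fun s => v (s - 1))) !v0 ?subr0 ?addr0 //; lia.
  by move=> s; congr v; ring.
have p1' : bisum (fun s => v (s + 1)) L = bisum v L.
  by rewrite bisum_shiftS !v0 ?subr0 ?addr0 //; lia.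
have p2 : bisum (fun s => v (s + 2)) L = bisum v L.
  rewrite -[RHS]p1' -(bisum_ext L (u := fun s => v (s + 1 + 1))).
    by rewrite (bisum_shiftS (fun s => v (s + 1))) !v0 ?subr0 ?addr0 //; lia.
  by move=> s; congr v; ring.
set k2 := p ^+ N ^+ 2; set k1 := - p ^+ N * g * (1 + p ^+ N ^+ 2 * p).
set k0 := 1 + p ^+ N ^+ 2 * p * g ^+ 2 + p ^+ N ^+ 4 * p ^+ 2.
rewrite (@bisum_ext _ (fun s => k2 * x ^+ 2 * v (s - 2) + k1 * x * v (s - 1) +
  k0 * v s + p * k1 / x * v (s + 1) + p ^+ 2 * k2 / x ^+ 2 * v (s + 2))).
  rewrite !bisumD !bisumZ m1 m2 p1' p2 -hv /theta_prod !big_ord_recr /=.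
  rewrite /k2 /k1 /k0 /g !exprSr; field.
  by rewrite x0 y0.
move=> s /=; rewrite /v !(expfzDr s) //.
have -> : x ^ (-1) = x^-1 by [].
have -> : x ^ (-2) = x ^- 2 by [].
have -> : x ^ 1 = x by [].
have -> : x ^ 2 = x ^+ 2 by [].
rewrite -/k2 -/k1 -/k0; field; exact: x0.
Qed.

(** The Dickson polynomial with parameter p at x + p / x; by [pair_coef_sym] the terms of degrees n
    and -n combine into it. *)
Definition dickson (x : C) (n : nat) : C := x ^+ n + (p / x) ^+ n.

Lemma theta_prod_dickson (x y : C) N : x != 0 -> y != 0 ->
  theta_prod p (x * y) N * theta_prod p (x / y) N =
  pair_coef p (y + y^-1) N 0 +
  \sum_(j < 2 * N) pair_coef p (y + y^-1) N j.+1 * dickson x j.+1.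
Proof.
move=> x0 y0; rewrite (theta_prod_bisum x0 y0 (leqnn _)) /bisum expr0z mulr1.
congr +%R; apply: eq_bigr => j _; rewrite (pair_coef_sym _ p0) /dickson.
rewrite mulrDr -exprnP; congr +%R.
by rewrite -exprnN expr_div_n mulrAC mulrA mulrC -mulrA mulrC.
Qed.

Lemma theta_pair_glim (x y : C) : x != 0 -> y != 0 ->
  glim r (fun N => pair_coef_lim (y + y^-1) 0 +
     \sum_(j < 2 * N) pair_coef_lim (y + y^-1) j.+1 * dickson x j.+1)
  (theta (x * y) p * theta (x / y) p).
Proof.
move=> x0 y0; set g := y + y^-1.
(* [tau] dominates x and p / x. The weight [2 * tau] leaves a factor 2^(-n) in degree n, so
   replacing all coefficients by their limits costs only O(r^N). *)
pose tau := nc x + nc (p / x).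
have tau0 : 0 < tau by rewrite ltr_wpDr ?nc_ge0 // nc_gt0.
have rho0 : 0 < 2 * tau by rewrite mulr_gt0.
have [K HK] := pair_coef_lim_bound g rho0.
have dick n : nc (dickson x n) <= 2 * tau ^+ n.
  apply: le_trans (ncD _ _) _; rewrite !ncX mulr_natl mulr2n lerD //.
    by rewrite lerXn2r ?nnegrE ?nc_ge0 ?(ltW tau0) // lerDl nc_ge0.
  by rewrite lerXn2r ?nnegrE ?nc_ge0 ?(ltW tau0) // lerDr nc_ge0.
have diff : glim r (fun N => (pair_coef_lim g 0 - pair_coef p g N 0) +
    \sum_(j < 2 * N) (pair_coef_lim g j.+1 - pair_coef p g N j.+1) * dickson x j.+1) 0.
  exists (K + 2 * K) => N; rewrite subr0 mulrDl; apply: le_trans (ncD _ _) _.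
  rewrite lerD //.
    by rewrite -opprB ncN; have := HK N 0; rewrite expr0z mulr1.
  have K0 : 0 <= K * r ^+ N by apply: le_trans (HK N 0); rewrite mulr_ge0 ?nc_ge0.
  have S n : nc (\sum_(j < n)
        (pair_coef_lim g j.+1 - pair_coef p g N j.+1) * dickson x j.+1) <=
      2 * K * r ^+ N * (1 - 2^-1 ^+ n).
    elim: n => [|n IH].
      by rewrite big_ord0 nc0 expr0 subrr mulr0.
    rewrite big_ord_recr /=; apply: le_trans (ncD _ _) _.
    have -> : 2 * K * r ^+ N * (1 - 2^-1 ^+ n.+1) =
       2 * K * r ^+ N * (1 - 2^-1 ^+ n) + 2 * K * r ^+ N * 2^-1 ^+ n.+1.
      by rewrite exprS; field.
    rewrite lerD // ncM -opprB ncN.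
    have := HK N n.+1; rewrite -exprnP exprMn mulrA -ler_pdivlMr ?exprn_gt0 //.
    rewrite -ler_pdivlMr ?exprn_gt0 // => h.
    apply: le_trans (ler_pM (nc_ge0 _) (nc_ge0 _) h (dick _)) _.
    rewrite exprVn le_eqVlt; apply/orP; left; apply/eqP.
    by field; rewrite !expf_neq0 // gt_eqF.
  apply: le_trans (S _) _; rewrite -[leRHS]mulr1.
  apply: ler_wpM2l; first by rewrite -mulrA mulr_ge0.
  by rewrite lerBlDr lerDl exprn_ge0 // invr_ge0.
have tl : glim r (fun N => theta_prod p (x * y) N * theta_prod p (x / y) N)
   (theta (x * y) p * theta (x / y) p) by apply: glimM => //; exact: theta_glim.
have := glimD tl diff; rewrite addr0; apply: glim_ext => N.
rewrite theta_prod_dickson // addrACA subrKC -big_split; congr +%R.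
by apply: eq_bigr => j _ /=; rewrite -mulrDl subrKC.
Qed.

End CoefficientLimits.

(** * The Weierstrass addition formula *)

Section Weierstrass.
Set Implicit Arguments.
Unset Strict Implicit.
Variables (R : realType) (p : R[i]).
Local Notation C := R[i].
Local Notation nc := (@ComplexField.Normc.normc R).
Hypothesis p1 : nc p < 1.

Let r01 : 0 <= nc p < 1. Proof. by rewrite nc_ge0. Qed.

Definition theta_pair (x y : C) : C := theta (x * y) p * theta (x / y) p.

Definition det3 (a b c d e f g h i : C) : C :=
  a * (e * i - f * h) - b * (d * i - f * g) + c * (d * h - e * g).

Lemma theta_p0 (x : C) : p = 0 -> theta x p = 1 - x.
Proof.
move=> p0; apply: (glim_unique r01 (theta_glim x p1)).
(* The constant serves N = 0, where the empty product is 1; from N = 1 on the product equals 1 -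
   x. *)
exists (nc x) => -[|N].
  by rewrite /theta_prod big_ord0 opprB addrCA subrr addr0 mulr1.
rewrite /theta_prod big_ord_recl big1 => [|j _]; last first.
  by rewrite p0 /= !exprS !mul0r subr0 mulr1.
rewrite /= p0 expr0 expr1 mul0r subr0 mul1r !mulr1 subrr nc0.
by rewrite exprS mul0r mulr0.
Qed.

Lemma theta_pair_sep : p != 0 -> exists (a b : C -> C) (A B : C -> nat -> C),
  forall x y, x != 0 -> y != 0 ->
  glim (nc p) (fun N => a y * A x N + b y * B x N) (theta_pair x y).
Proof.
move=> p0.
exists (fun y => pair_coef_lim p (y + y^-1) 0), (fun y => pair_coef_lim p (y + y^-1) 1).
(* The degree is j + 1, so odd [j] gives the even degrees; the leading 1 is degree 0. *)
exists (fun x N => 1 + \sum_(j < 2 * N | odd j) rank_coef p j.+1 * dickson p x j.+1).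
exists (fun x N => \sum_(j < 2 * N | ~~ odd j) rank_coef p j.+1 * dickson p x j.+1).
move=> x y x0 y0; apply: glim_ext (theta_pair_glim p0 p1 x0 y0) => N.
rewrite mulrDr mulr1 -addrA !mulr_sumr; congr +%R.
rewrite (bigID (fun j : 'I_(2 * N) => odd j)) /=; congr +%R.
  apply: eq_bigr => j oj; rewrite (pair_coef_lim_rank p0 p1 _ j.+1) /= oj /=.
  by rewrite mulrCA mulrA.
apply: eq_bigr => j /negbTE oj; rewrite (pair_coef_lim_rank p0 p1 _ j.+1) /= oj /=.
by rewrite mulrCA mulrA.
Qed.

(** The approximants from [theta_pair_sep] form matrices of rank at most 2, whose 3 x 3 determinants
    are zero; this passes to the limit. For p = 0 the claim is a rational identity. *)
Lemma theta_pair_minor (x1 x2 x3 y1 y2 y3 : C) :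
  x1 != 0 -> x2 != 0 -> x3 != 0 -> y1 != 0 -> y2 != 0 -> y3 != 0 ->
  let T := theta_pair in
  det3 (T x1 y1) (T x1 y2) (T x1 y3) (T x2 y1) (T x2 y2) (T x2 y3)
    (T x3 y1) (T x3 y2) (T x3 y3) = 0.
Proof.
move=> x10 x20 x30 y10 y20 y30 T; rewrite /T.
have [p0|p0] := eqVneq p 0.
  rewrite /theta_pair !theta_p0 // /det3; field.
  by rewrite y10 y20 y30.
have [a [b [A [B H]]]] := theta_pair_sep p0.
pose M i j N := a j * A i N + b j * B i N.
have lim i j : i != 0 -> j != 0 -> glim (nc p) (M i j) (theta_pair i j).
  exact: H.
have z : glim (nc p) (fun N => det3 (M x1 y1 N) (M x1 y2 N) (M x1 y3 N)
   (M x2 y1 N) (M x2 y2 N) (M x2 y3 N) (M x3 y1 N) (M x3 y2 N) (M x3 y3 N)) 0.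
  apply: glim_ext (glim_cst _ 0) => N.
  by rewrite /det3 /M; ring.
apply: (glim_unique r01 _ z); rewrite /det3.
by apply: glimD; [apply: glimB|]; apply: glimM (lim _ _ _ _) _ => //;
  apply: glimB; apply: glimM (lim _ _ _ _) (lim _ _ _ _).
Qed.

Lemma theta1 : theta 1 p = 0.
Proof.
have := theta_inv p1 (oner_neq0 C); rewrite invr1 mul1r => /eqP.
by rewrite -subr_eq0 opprK -mulr2n mulrn_eq0 /= => /eqP.
Qed.

Lemma theta_pair_antisym (x y : C) : x != 0 -> y != 0 ->
  theta_pair y x / y = - (theta_pair x y / x).
Proof.
move=> x0 y0; have xy0 : x / y != 0 by rewrite mulf_neq0 ?invr_eq0.
have h := theta_inv p1 xy0; rewrite /theta_pair -[theta (x / y) p]opprK -h.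
by rewrite invf_div [y * x]mulrC; field; rewrite x0 y0.
Qed.

(* The matrix with entries [theta_pair x_i x_j / x_i] is antisymmetric and of
   rank at most 2, so its 4 x 4 Pfaffian, multiplied by any entry, is a
   3 x 3 minor and vanishes. *)
Lemma theta_weierstrass (x y u v : C) :
  x != 0 -> y != 0 -> u != 0 -> v != 0 ->
  theta (x * y) p * theta (x / y) p * (theta (u * v) p * theta (u / v) p) -
  theta (x * v) p * theta (x / v) p * (theta (u * y) p * theta (u / y) p) =
  u / y * (theta (y * v) p * theta (y / v) p * (theta (x * u) p * theta (x / u) p)).
Proof.
move=> x0 y0 u0 v0.
pose s i j := theta_pair i j / i.
have asym i j : i != 0 -> j != 0 -> s j i = - s i j.
  by move=> i0 j0; exact: theta_pair_antisym.
have diag i : i != 0 -> s i i = 0.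
  by move=> i0; rewrite /s /theta_pair divff // theta1 mulr0 mul0r.
pose Pf i j k l := s i j * s k l - s i k * s j l + s i l * s j k.
have minor i j k l : i != 0 -> j != 0 -> k != 0 -> l != 0 ->
    s j k * Pf i j k l = 0.
  move=> i0 j0 k0 l0.
  (* Rows i, j, k meet columns j, k, l: the entries at (j, j) and (k, k) vanish, leaving [s j k]
     times the Pfaffian. *)
  have := @theta_pair_minor i j k j k l i0 j0 k0 j0 k0 l0.
  have e m n : m != 0 -> theta_pair m n = m * s m n.
    by move=> m0; rewrite /s mulrCA divff // mulr1.
  rewrite /= !e // !diag // (asym j k) // => h.
  have ijk : i * j * k != 0 by rewrite !mulf_neq0.
  apply: (mulfI ijk); rewrite mulr0 -[RHS]h /det3 /Pf; ring.
have Pf0 : Pf x y u v = 0.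
  (* A nonzero Pfaffian would force [s y u], [s y v] and [s x y] to vanish, by three orderings of
     the points; each of its terms contains one of them. *)
  have [//|nz] := eqVneq (Pf x y u v) 0.
  have h1 := minor x y u v x0 y0 u0 v0.
  have h2 := minor x y v u x0 y0 v0 u0.
  have h3 := minor u y x v u0 y0 x0 v0.
  have s1 : s y u = 0 by apply: (mulIf nz); rewrite mul0r.
  have s2 : s y v = 0.
    apply: (mulIf nz); rewrite mul0r -[RHS]oppr0 -[in RHS]h2 /Pf.
    by rewrite (asym u v) //; ring.
  have s3 : s x y = 0.
    apply: (mulIf nz); rewrite mul0r -[RHS]h3 /Pf.
    by rewrite (asym x u) // (asym y u) // (asym x y) //; ring.
  by rewrite /Pf s1 s2 s3 !(mul0r, mulr0, addr0, subr0).
rewrite -!/(theta_pair _ _).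
have e m n : m != 0 -> theta_pair m n = m * s m n.
  by move=> m0; rewrite /s mulrCA divff // mulr1.
rewrite !e // (asym y u) //.
apply/eqP; rewrite -subr_eq0; apply/eqP.
rewrite -[RHS](mulr0 (x * u)) -[in RHS]Pf0 /Pf.
by field.
Qed.

(** With t^2 = a, this is the addition formula at x t, Q / t, t q / Q, b q / t. For Q = q^(c+1) it
    is the recursion for E_c with denominators cleared. *)
Lemma theta_column (a b q x Q : C) :
  a != 0 -> b != 0 -> q != 0 -> x != 0 -> Q != 0 ->
  theta (x * Q) p * theta (a * x / Q) p *
    (theta (b * q ^+ 2 / Q) p * theta (a / (b * Q)) p) =
  theta q p * theta (a * q / Q ^+ 2) p *
    (theta (b * x * q) p * theta (a * x / (b * q)) p) +
  q * (theta (b * q / Q) p * theta (a / (b * q * Q)) p *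
    (theta (x * Q / q) p * theta (a * x * q / Q) p)).
Proof.
move=> a0 b0 q0 x0 Q0.
have [t t0 ta] : exists2 t : C, t != 0 & t ^+ 2 = a.
  by exists (sqrtc a); rewrite ?sqrtc_eq0 // sqr_sqrtc.
have n1 : x * t != 0 by rewrite mulf_neq0.
have n2 : Q / t != 0 by rewrite mulf_neq0 ?invr_eq0.
have n3 : t * q / Q != 0 by rewrite !mulf_neq0 ?invr_eq0.
have n4 : b * q / t != 0 by rewrite !mulf_neq0 ?invr_eq0.
have := theta_weierstrass n1 n2 n3 n4.
have -> : x * t * (Q / t) = x * Q by field.
have -> : x * t / (Q / t) = a * x / Q by rewrite -ta; field; rewrite t0 Q0.
have -> : t * q / Q * (b * q / t) = b * q ^+ 2 / Q by field; rewrite t0 Q0.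
have -> : t * q / Q / (b * q / t) = a / (b * Q).
  by rewrite -ta; field; rewrite t0 Q0 b0 q0.
have -> : x * t * (b * q / t) = b * x * q by field.
have -> : x * t / (b * q / t) = a * x / (b * q).
  by rewrite -ta; field; rewrite t0 b0 q0.
have -> : t * q / Q * (Q / t) = q by field; rewrite t0 Q0.
have -> : t * q / Q / (Q / t) = a * q / Q ^+ 2 by rewrite -ta; field; rewrite t0 Q0.
have -> : Q / t * (b * q / t) = (a / (b * q * Q))^-1.
  by rewrite -ta; field; rewrite t0 Q0 b0 q0.
have -> : Q / t / (b * q / t) = (b * q / Q)^-1 by field; rewrite t0 Q0 b0 q0.
have -> : x * t * (t * q / Q) = a * x * q / Q by rewrite -ta; field.
have -> : x * t / (t * q / Q) = x * Q / q by field; rewrite t0 Q0 q0.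
move=> /eqP; rewrite subr_eq => /eqP ->.
(* Two arguments come out inverted; the prefactors from [theta_inv] and the addition formula combine
   to q. *)
have h1 : theta (a / (b * q * Q))^-1 p =
    - theta (a / (b * q * Q)) p / (a / (b * q * Q)).
  rewrite -(theta_inv p1) ?mulf_neq0 ?invr_eq0 ?mulf_neq0 //.
  by field; rewrite a0 Q0 b0 q0.
have h2 : theta (b * q / Q)^-1 p = - theta (b * q / Q) p / (b * q / Q).
  rewrite -(theta_inv p1) ?mulf_neq0 ?invr_eq0 ?mulf_neq0 //.
  by field; rewrite Q0 b0 q0.
rewrite h1 h2; field.
by rewrite a0 Q0 b0 q0.
Qed.

End Weierstrass.

(** * Elliptic numbers of single columns *)

Section Columns.
Set Implicit Arguments.
Unset Strict Implicit.
Variable R : realType.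
Local Notation C := R[i].
Local Notation nc := (@ComplexField.Normc.normc R).

Lemma cexpD (x y : C) : cexp (x + y) = cexp x * cexp y.
Proof.
case: x => a b; case: y => c d; rewrite /cexp /= expRD cosD sinD.
by apply/eqP; rewrite eq_complex /=; apply/andP; split; apply/eqP; ring.
Qed.

Lemma cexp0 : cexp 0 = 1 :> C.
Proof. by apply/eqP; rewrite eq_complex /= expR0 cos0 sin0 mulr1 mulr0 !eqxx. Qed.

Lemma cexp_neq0 (x : C) : cexp x != 0.
Proof.
by apply/eqP => h; move/eqP: cexp0; rewrite -(subrr x) cexpD h mul0r eq_sym oner_eq0.
Qed.

Lemma cpowD (l x y : C) : cpow l (x + y) = cpow l x * cpow l y.
Proof. by rewrite /cpow mulrDl cexpD. Qed.

Lemma cpow_nat (l : C) n : cpow l n%:R = cexp l ^+ n.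
Proof.
elim: n => [|n IH]; first by rewrite /cpow mul0r cexp0 expr0.
by rewrite -[in LHS]addn1 natrD cpowD IH exprSr /cpow mul1r.
Qed.

Variables (a b l p z : C).
Let q := cexp l.
Let x := cpow l z.
Hypotheses (a0 : a != 0) (b0 : b != 0) (p1 : nc p < 1).

Let q0 : q != 0. Proof. exact: cexp_neq0. Qed.
Let x0 : x != 0. Proof. exact: cexp_neq0. Qed.

Definition column_ellnum (c : nat) : C :=
  ellnum (a * q ^- (2 * c)) (b * q ^- c) l p (z + c%:R).

Lemma ellnum_numE c :
  ellnum_num (a * q ^- (2 * c)) (b * q ^- c) l p (z + c%:R) =
  theta (x * q ^+ c) p * theta (a * x / q ^+ c) p *
    (theta (b * q ^+ 2 / q ^+ c) p * theta (a / (b * q ^+ c)) p).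
Proof.
have Q0 : q ^+ c != 0 by rewrite expf_neq0.
rewrite /ellnum_num /thetas !big_cons big_nil mulr1 -/q cpowD cpow_nat -/x -/q.
rewrite mulnC exprM.
have -> : a / q ^+ c ^+ 2 * (x * q ^+ c) = a * x / q ^+ c by field.
have -> : b / q ^+ c * q ^+ 2 = b * q ^+ 2 / q ^+ c by field.
have -> : a / q ^+ c ^+ 2 / (b / q ^+ c) = a / (b * q ^+ c).
  by field; rewrite Q0 b0.
by rewrite !mulrA.
Qed.

(** Only the second theta depends on [c]; the other three already occur in the denominator of
    [z]. *)
Lemma ellnum_denE c :
  ellnum_den (a * q ^- (2 * c)) (b * q ^- c) l p (z + c%:R) =
  theta q p * theta (a * q / q ^+ c ^+ 2) p *
    (theta (b * x * q) p * theta (a * x / (b * q)) p).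
Proof.
have Q0 : q ^+ c != 0 by rewrite expf_neq0.
rewrite /ellnum_den /thetas !big_cons big_nil mulr1 -/q.
have q1 : cpow l 1 = q by rewrite /cpow mul1r.
have e1 : cpow l (z + c%:R + 1) = x * q ^+ c * q.
  by rewrite !cpowD cpow_nat q1.
have e2 : cpow l (z + c%:R - 1) = x * q ^+ c / q.
  apply: (mulIf q0); rewrite divfK // -q1 -cpowD addrNK q1.
  by rewrite cpowD cpow_nat.
rewrite e1 e2 mulnC exprM.
have -> : a / q ^+ c ^+ 2 * q = a * q / q ^+ c ^+ 2 by field.
have -> : b / q ^+ c * (x * q ^+ c * q) = b * x * q by field.
have -> : a / q ^+ c ^+ 2 * (x * q ^+ c / q) / (b / q ^+ c) = a * x / (b * q).
  by field; rewrite Q0 b0 q0.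
by rewrite !mulrA.
Qed.

Lemma w_numE c : w_num a b q p (1 - c.+1%:Z) =
  theta (a * q / q ^+ c ^+ 2) p * (theta (b / q ^+ c) p *
    theta (a / (b * q ^+ 2 * q ^+ c)) p).
Proof.
have Q0 : q ^+ c != 0 by rewrite expf_neq0.
rewrite /w_num /thetas !big_cons big_nil mulr1 -/q.
have -> : 1 - c.+1%:Z = - c%:Z by lia.
have qN (n : nat) : q ^ (- n%:Z) = (q ^+ n)^-1 by rewrite -exprnN.
have -> : 2 * - c%:Z + 1 = - (c * 2)%N%:Z + 1 by lia.
have -> : - c%:Z - 2 = - (c + 2)%N%:Z by lia.
rewrite expfzDr // !qN expr1z exprM exprD.
congr (theta _ p * (_ * theta _ p)); first by field.
by field; rewrite Q0 b0 q0.
Qed.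

Lemma w_denE c : w_den a b q p (1 - c.+1%:Z) =
  theta (a * q / q ^+ c.+1 ^+ 2) p * (theta (b * q ^+ 2 / q ^+ c) p *
    theta (a / (b * q ^+ c)) p).
Proof.
have Q0 : q ^+ c != 0 by rewrite expf_neq0.
rewrite /w_den /thetas !big_cons big_nil mulr1 -/q.
have -> : 1 - c.+1%:Z = - c%:Z by lia.
have qN (n : nat) : q ^ (- n%:Z) = (q ^+ n)^-1 by rewrite -exprnN.
have -> : 2 * - c%:Z - 1 = - (c * 2 + 1)%N%:Z by lia.
rewrite (expfzDr (- c%:Z)) // !qN exprD exprM (exprS q c).
have -> : q ^ 2 = q ^+ 2 by [].
congr (theta _ p * (theta _ p * theta _ p)).
- by field; rewrite Q0 q0.
- by field.
- by field; rewrite Q0 b0.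
Qed.

(** The weight cancels factors of E_c so that w(-c) E_c has the denominator of E_(c+1); what remains
    is [theta_column] at Q = q^(c+1). *)
Lemma column_ellnum_step c :
  ellnum_den a b l p z != 0 -> w_den a b q p (1 - c.+1%:Z) != 0 ->
  theta (a * q / q ^+ c ^+ 2) p != 0 ->
  column_ellnum c.+1 = 1 + w a b q p (1 - c.+1%:Z) * column_ellnum c.
Proof.
move=> zd wd tc.
have Q0 : q ^+ c != 0 by rewrite expf_neq0.
have [tq _ tb ta] : [/\ theta q p != 0, theta (a * q / q ^+ 0 ^+ 2) p != 0,
    theta (b * x * q) p != 0 & theta (a * x / (b * q)) p != 0].
  move: zd (ellnum_denE 0); rewrite addr0 muln0 expr0 !invr1 !mulr1 => zd e.
  by move: zd; rewrite e !mulf_eq0 !negb_or => /andP[/andP[-> ->] /andP[-> ->]].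
move: wd; rewrite w_denE !mulf_eq0 !negb_or => /and3P[w1 w2 w3].
rewrite /column_ellnum /ellnum /w !ellnum_numE !ellnum_denE w_numE w_denE.
have Q10 : q ^+ c.+1 != 0 by rewrite expf_neq0.
rewrite theta_column //.
have -> : b * q / q ^+ c.+1 = b / q ^+ c.
  by rewrite exprS; field; rewrite Q0 q0.
have -> : a / (b * q * q ^+ c.+1) = a / (b * q ^+ 2 * q ^+ c).
  by rewrite exprS; field; rewrite Q0 q0 b0.
have -> : x * q ^+ c.+1 / q = x * q ^+ c.
  by rewrite exprS; field.
have -> : a * x * q / q ^+ c.+1 = a * x / q ^+ c.
  by rewrite exprS; field; rewrite Q0 q0.
by field; rewrite tq tb ta tc w1 w2 w3.
Qed.

(** The recursion unrolled: [r] is the row of the rook, with r = 0 for an empty column, which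
    contributes [z]; the weights of the rows above [r] remain. *)
Lemma column_ellnum_sum c :
  ellnum_den a b l p z != 0 ->
  (forall j : nat, (0 < j <= c)%N -> w_den a b q p (1 - j%:Z) != 0) ->
  column_ellnum c =
  \sum_(r < c.+1) (if r == 0%N :> nat then ellnum a b l p z else 1) *
    \prod_(r.+1 <= j < c.+1) w a b q p (1 - j%:Z).
Proof.
move=> zd; elim: c => [|c IH] wd.
  rewrite big_ord_recl big_ord0 addr0 /= big_geq // mulr1 /column_ellnum.
  by rewrite muln0 expr0 !invr1 !mulr1 addr0.
rewrite column_ellnum_step //; last 2 first.
- by apply: wd; rewrite ltnS leqnn.
(* For c = 0 the required theta is a factor of the denominator of [z]; otherwise it is the first
   factor of [w_den] in row c. *)
- case: c wd {IH} => [|c] wd.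
    move: zd (ellnum_denE 0); rewrite addr0 muln0 expr0 !invr1 !mulr1 => zd e.
    move: zd; rewrite e !mulf_eq0 !negb_or => /andP[/andP[_ h] _].
    by move: h; rewrite expr1n invr1 mulr1.
  have := wd c.+1; rewrite leqnSn => /(_ isT).
  by rewrite w_denE !mulf_eq0 !negb_or => /and3P[].
rewrite big_ord_recr /= big_geq // !mulr1 addrC; congr +%R.
rewrite IH => [|j /andP[j0 jc]]; last by rewrite wd // j0 leqW.
rewrite mulr_sumr; apply: eq_bigr => r _.
by rewrite [in RHS]big_nat_recr /= ?ltn_ord // mulrCA [w _ _ _ _ _ * _]mulrC.
Qed.

End Columns.

(** * File placements as a choice of row in every column *)

Section FilePlacementSums.
Set Implicit Arguments.
Unset Strict Implicit.
Variables (K : comNzRingType) (n : nat) (c : 'I_n -> nat).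
Let m := (\max_(i < n) c i).+1.
Let B := skyline c.

(* A file placement is encoded by the row of the rook in every column, with
   row 0 standing for the absence of a rook. *)
Definition placement_of (f : {ffun 'I_n -> 'I_m}) : {set cell n m} :=
  [set x : cell n m | (0 < x.2)%N && (f x.1 == x.2)].

Definition rook_rows (Q : {set cell n m}) : {ffun 'I_n -> 'I_m} :=
  [ffun i => odflt ord0 [pick r | (i, r) \in Q]].

Definition file_placement (Q : {set cell n m}) : bool :=
  (Q \subset B) && [forall x in Q, forall y in Q, (x.1 == y.1) ==> (x == y)].

Lemma file_placement_inj Q (x y : cell n m) : file_placement Q ->
  x \in Q -> y \in Q -> x.1 = y.1 -> x = y.
Proof.
move=> /andP[_ /forall_inP h] xQ yQ e.
by have /forall_inP /(_ y yQ) := h x xQ; rewrite e eqxx => /eqP.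
Qed.

Lemma skylineP (x : cell n m) : (x \in B) = (0 < x.2 <= c x.1)%N.
Proof. by rewrite inE. Qed.

Lemma placement_ofK : cancel placement_of rook_rows.
Proof.
move=> f; apply/ffunP => i; rewrite ffunE; case: pickP => [r|h] /=.
  by rewrite inE /= => /andP[_ /eqP].
have := h (f i); rewrite inE /= eqxx andbT lt0n => /negbFE /eqP e.
by apply: val_inj; rewrite /= e.
Qed.

Lemma rook_rowsK Q : file_placement Q -> placement_of (rook_rows Q) = Q.
Proof.
move=> fQ; have /andP[sQ _] := fQ; apply/setP => -[i r]; rewrite inE /= ffunE.
case: pickP => [r' r'Q|h] /=; last first.
  rewrite h; apply/negbTE; case: (posnP r) => // r0.
  by apply/eqP => e; move: r0; rewrite -e.
apply/andP/idP => [[_ /eqP <-] //|rQ].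
have := file_placement_inj fQ rQ r'Q erefl => -[->]; split=> //.
by have := fintype.subsetP sQ _ r'Q; rewrite skylineP => /andP[].
Qed.

Lemma file_placement_of f :
  file_placement (placement_of f) = [forall i, (f i <= c i)%N].
Proof.
apply/andP/forallP => [[/fintype.subsetP sQ _] i|h].
  case: (posnP (f i)) => [-> //|f0].
  have := sQ (i, f i); rewrite inE /= f0 eqxx => /(_ isT).
  by rewrite skylineP => /andP[].
split.
  apply/fintype.subsetP => -[i r]; rewrite skylineP inE /= => /andP[-> /eqP <-].
  exact: h.
apply/forall_inP => -[i r]; rewrite inE /= => /andP[_ /eqP <-].
apply/forall_inP => -[j s]; rewrite inE /= => /andP[_ /eqP <-].
by apply/implyP => /eqP ->.
Qed.

(** A rook leaves the cells strictly above it; when f is 0, the same formula gives the whole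
    column. *)
Lemma uncancelled_placement_of f (x : cell n m) :
  (x \in uncancelled B (placement_of f)) = (f x.1 < x.2 <= c x.1)%N.
Proof.
case: x => i r; rewrite inE skylineP /=.
have -> : cancelled (placement_of f) (i, r) = (r < f i)%N.
  apply/existsP/idP => [[[j s]]|h].
    by rewrite inE /= => /andP[/andP[_ /eqP <-] /andP[/eqP -> ]].
  by exists (i, f i); rewrite inE /= !eqxx h (leq_ltn_trans _ h).
rewrite inE /= -leqNgt.
have -> : (f i == r) = (f i == r :> nat) by [].
by apply/idP/idP; lia.
Qed.

Lemma card_placement_of f : #|placement_of f| = #|[pred i | f i != 0 :> nat]|.
Proof.
rewrite -(card_in_imset (f := fun i => (i, f i))) => [|i j _ _ [] //].
apply: eq_card => -[i r]; rewrite inE /=; apply/andP/imsetP => [[r0 /eqP e]|].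
  by exists i; rewrite ?inE ?e -?lt0n.
by move=> [j]; rewrite inE => j0 [-> ->]; rewrite lt0n.
Qed.

Lemma file_placement_card Q : file_placement Q -> (#|Q| <= n)%N.
Proof.
by move=> /rook_rowsK <-; rewrite card_placement_of -[n in leqRHS]card_ord max_card.
Qed.

(** Both factors split over the columns: the exponent of [X] counts the empty ones, and the cells
    left in a column form an interval of rows. *)
Lemma placement_weight (wt : nat -> K) (X : K) f :
  (\prod_(x in uncancelled B (placement_of f)) wt x.2) *
    X ^+ (n - #|placement_of f|) =
  \prod_(i < n) ((if f i == 0%N :> nat then X else 1) *
    \prod_((f i).+1 <= j < (c i).+1) wt j).
Proof.
rewrite big_split mulrC; congr (_ * _).
  rewrite -big_mkcond prodr_const card_placement_of; congr (X ^+ _).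
  have := cardC [pred i | f i != 0%N :> nat]; rewrite card_ord => e.
  have sub (x y t : nat) : (x + y)%N = t -> (t - x)%N = y.
    by move=> <-; rewrite addKn.
  rewrite (sub _ _ _ e).
  by apply: eq_card => i; rewrite !inE negbK.
rewrite (eq_bigl (fun x : cell n m => true && (f x.1 < x.2 <= c x.1)%N)); last first.
  by move=> x; rewrite uncancelled_placement_of.
rewrite -(pair_big_dep xpredT (fun i (r : 'I_m) => f i < r <= c i)%N
  (fun i (r : 'I_m) => wt r)) /=.
apply: eq_bigr => i _; rewrite big_geq_mkord.
rewrite (big_ord_widen_cond m (fun j => f i < j)%N wt) //.
by rewrite /m ltnS; exact: (leq_bigmax i).
Qed.

(** Distributivity yields a sum over row choices, that is, over file placements of all sizes, which
    are then grouped by their number of rooks. *)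
Lemma prod_column_sums (wt : nat -> K) (X : K) :
  \prod_(i < n) \sum_(r < (c i).+1) (if r == 0%N :> nat then X else 1) *
    \prod_(r.+1 <= j < (c i).+1) wt j =
  \sum_(k < n.+1) (\sum_(Q in file_placements (n - k) B)
    \prod_(x in uncancelled B Q) wt x.2) * X ^+ k.
Proof.
transitivity (\sum_(Q | file_placement Q)
    (\prod_(x in uncancelled B Q) wt x.2) * X ^+ (n - #|Q|)).
  pose F i r := (if r == 0%N :> nat then X else 1) *
    \prod_(r.+1 <= j < (c i).+1) wt j.
  have -> : \prod_(i < n) \sum_(r < (c i).+1) F i r =
      \prod_(i < n) \sum_(r < m | (r <= c i)%N) F i r.
    by apply: eq_bigr => i _; rewrite (big_ord_widen m (F i)) // ltnS (leq_bigmax i).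
  rewrite (bigA_distr_big_dep (fun i (r : 'I_m) => (r <= c i)%N)).
  rewrite (reindex_onto placement_of rook_rows); last exact: rook_rowsK.
  apply: eq_big => f; last by rewrite placement_weight.
  rewrite placement_ofK eqxx andbT file_placement_of.
  by apply/familyP/forallP.
under [RHS]eq_bigr do rewrite mulr_suml.
rewrite (exchange_big_dep file_placement) /=; last first.
  by move=> k Q _; rewrite inE /file_placement => /and3P[-> _ ->].
apply: eq_bigr => Q fQ.
(* With at most [n] rooks, exactly one k <= n makes the truncated difference n - k equal to their
   number. *)
have Qn := file_placement_card fQ.
have kn : (n - #|Q| < n.+1)%N by rewrite ltnS leq_subr.
rewrite (big_pred1 (Ordinal kn)) // => k; rewrite inE.
move: fQ; rewrite /file_placement => /andP[-> ->]; rewrite andbT /= -val_eqE /=.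
move: {kn} #|Q| Qn (nat_of_ord k) (ltn_ord k) => d dn j jn.
by apply/eqP/eqP; lia.
Qed.

End FilePlacementSums.


(* The last three hypotheses are the genericity assumption: the denominators of
   the weights and elliptic numbers that occur in the identity do not vanish. *)
Theorem theorem5p4 (R : realType) (n : nat) (c : 'I_n -> nat)
    (a b q l p z : R[i])
    (a_neq0 : a != 0) (b_neq0 : b != 0) (ql : cexp l = q) (p_lt1 : `|p| < 1)
    (w_gen : forall (i : 'I_n) (j : nat), (0 < j <= c i)%N ->
       w_den a b q p (1 - j%:Z) != 0)
    (z_gen : ellnum_den a b l p z != 0)
    (zc_gen : forall i : 'I_n,
       ellnum_den (a * q ^- (2 * c i)) (b * q ^- (c i)) l p (z + (c i)%:R) != 0) :
  \prod_(i < n)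
     ellnum (a * q ^- (2 * c i)) (b * q ^- (c i)) l p (z + (c i)%:R) =
  \sum_(k < n.+1)
     file_number a b q p (skyline c) (n - k) * ellnum a b l p z ^+ k.
Proof.
(* The norm on [R[i]] is itself complex-valued; the estimates use the real modulus. *)
have p1 : ComplexField.Normc.normc p < 1.
  by move: p_lt1; rewrite normc_def ltcR; case: (p).
rewrite -ql in w_gen zc_gen *.
rewrite -(prod_column_sums c (fun j => w a b (cexp l) p (1 - j%:Z))).
apply: eq_bigr => i _.
exact: (column_ellnum_sum a_neq0 b_neq0 p1 z_gen (@w_gen i)).
Qed.
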